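(* Let $G$ be an arbitrary finite simple $3$-regular graph. In the unbiased Chooser-Picker degree game played on $E(G)$, Picker has a strategy which guarantees, against every play of Chooser, that at the end of the game every vertex of $G$ has degree at least one in Picker's subgraph $G_P$. Equivalently, $\delta_P(G)\ge 1$.
   Context: Chooser-Picker (also called Client-Waiter) game on the edge set of a graph $G$: in each turn Picker selects a pair of previously unclaimed edges of $G$ and offers them to Chooser. Chooser claims exactly one of the two edges for Chooser's subgraph $G_C$, and the other edge is allocated to Picker's subgraph $G_P$. This continues until all edges of $G$ are claimed; if the total number of edges is odd, the final remaining single edge is automatically assigned to Chooser. In the Chooser-Picker degree game, Chooser is the attacker (Maker), aiming at a large maximum degree in $G_C$, and Picker is the defender (Breaker), aiming at a large minimum degree in $G_P$. For a simple graph $G$, $\delta_P(G)$ denotes the largest integer $t$ such that Picker has a strategy guaranteeing that, at the end of the Chooser-Picker degree game, every vertex of $G$ is incident to at least $t$ edges of $G_P$. *)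

(* Defs.v *)
From HB Require Import structures.
From mathcomp Require Import all_boot.

Set Implicit Arguments.
Unset Strict Implicit.
Unset Printing Implicit Defensive.

(* A simple graph on the vertex type [T] is a symmetric irreflexive relation
   [e : rel T]; an edge is the unordered pair [set x; y] of its endpoints. *)
Section ChooserPicker.

Variables (T : finType) (e : rel T).

Definition simple_graph : Prop := symmetric e /\ irreflexive e.

Definition edges : {set {set T}} :=
  [set [set p.1; p.2] | p : T * T & e p.1 p.2].

Definition degree (F : {set {set T}}) (x : T) : nat :=
  #|[set a in F | x \in a]|.

Definition regular (k : nat) : Prop := forall x : T, degree edges x = k.

(* The completed rounds, oldest first.  A round is recorded as
   (edge claimed by Chooser, edge allocated to Picker). *)
Definition history := seq ({set T} * {set T}).

Definition unclaimed (h : history) : {set {set T}} :=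
  [set a in edges | (a \notin unzip1 h) && (a \notin unzip2 h)].

(* When the game stops with a single unclaimed edge, that edge goes to
   Chooser, so Picker's subgraph is always read off the completed rounds. *)
Definition picker_graph (h : history) : {set {set T}} := [set a in unzip2 h].

Definition game_over (h : history) : bool := #|unclaimed h| <= 1.

(* A strategy of Picker: the two edges to offer after a given history. *)
Definition picker_strategy := history -> {set T} * {set T}.

(* The histories that can arise when Picker follows [s] and Chooser makes
   arbitrary choices. *)
Inductive play (s : picker_strategy) : history -> Prop :=
| play_start : play s [::]
| play_fst h : play s h -> ~~ game_over h ->
    play s (rcons h ((s h).1, (s h).2))
| play_snd h : play s h -> ~~ game_over h ->
    play s (rcons h ((s h).2, (s h).1)).

Definition legal (s : picker_strategy) : Prop :=
  forall h, play s h -> ~~ game_over h ->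
  [/\ (s h).1 \in unclaimed h, (s h).2 \in unclaimed h & (s h).1 != (s h).2].

Definition picker_guarantees (t : nat) : Prop :=
  exists2 s : picker_strategy, legal s &
    forall h, play s h -> game_over h ->
    forall x : T, t <= degree (picker_graph h) x.

(* "delta_P(G) = t".  There is exactly one such t as soon as G has a vertex;
   on the graph without vertices every t is guaranteed and there is none. *)
Definition is_delta_P (t : nat) : Prop :=
  picker_guarantees t /\ forall t', picker_guarantees t' -> t' <= t.

End ChooserPicker.

(* Main.v *)
Require Import Defs.
From mathcomp Require Import all_boot.
From mathcomp Require Import zify.

(** Call a vertex uncovered while Picker has no edge at it, and call it
    endangered if, moreover, fewer than three of its edges are unclaimed.  A
    round in which both offered edges share a vertex [x] covers [x], whatever
    Chooser does, and it covers the far end of Picker's edge as well.  Only the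
    far end of Chooser's edge can therefore become endangered, and if it had
    three unclaimed edges before, then it still has two.

    So Picker never needs to face more than one endangered vertex: if there is
    one, offer two edges at it; if there is none, offer two edges at any
    uncovered vertex.  In both cases the offered vertex is an uncovered vertex
    with the fewest unclaimed edges.  The invariant [safe] records that an
    uncovered vertex keeps two unclaimed edges and that at most one vertex is
    endangered ([safe_rcons]).  When at most one edge is unclaimed, no vertex
    can be uncovered any more ([min_degree3_guarantees1]).

    That the optimum exists, and is in fact 1, follows by counting.  Picker owns
    at most half of the edges, so in a k-regular graph Picker's average
    degree is at most k / 2 ([guarantee_le_half]). *)

Set Implicit Arguments.
Unset Strict Implicit.
Unset Printing Implicit Defensive.

Section Game.

Variables (T : finType) (e : rel T).
Implicit Types (h : history T) (s : picker_strategy T) (x y : T).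
Implicit Types (a c p : {set T}) (A : {set {set T}}).

(** * Degrees and unclaimed edges *)

Lemma card_edge a : simple_graph e -> a \in edges e -> #|a| = 2.
Proof.
move=> [_ irr] /imsetP[[x y]]; rewrite inE /= => exy ->.
by rewrite cards2; case: eqVneq exy => // ->; rewrite irr.
Qed.

Lemma degreeD1 A a x :
  a \in A -> degree A x = (x \in a) + degree (A :\ a) x.
Proof.
move=> aA; rewrite /degree (cardsD1 a) !inE aA; congr (_ + _).
by apply: eq_card => b; rewrite !inE andbA.
Qed.

Lemma degree_le_card A x : degree A x <= #|A|.
Proof. by apply/subset_leq_card/subsetP => a; rewrite inE => /andP[]. Qed.

Lemma handshake A :
  simple_graph e -> A \subset edges e -> \sum_x degree A x = #|A|.*2.
Proof.
move=> simple_e /subsetP Ae.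
rewrite -muln2 -sum_nat_const.
transitivity (\sum_x \sum_(a in A) (x \in a)).
  by apply: eq_bigr => x _; rewrite -big_mkcondr /= sum1dep_card.
rewrite exchange_big /=; apply: eq_bigr => a /Ae /(card_edge simple_e) <-.
by rewrite -sum1_card [RHS]big_mkcond /=; apply: eq_bigr => x _; case: (x \in a).
Qed.

Lemma unclaimed_nil : unclaimed e [::] = edges e.
Proof. by apply/setP => a; rewrite inE andbT. Qed.

Lemma unclaimed_rcons h c p :
  unclaimed e (rcons h (c, p)) = unclaimed e h :\ c :\ p.
Proof.
apply/setP => a; rewrite !inE /unzip1 /unzip2 !map_rcons !mem_rcons !in_cons !negb_or /=.
by case: (a == c); case: (a == p); rewrite ?andbF.
Qed.

(** * Keeping at most one vertex endangered *)

Definition uncovered h x : bool := all (fun a => x \notin a) (unzip2 h).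

Lemma degree_picker_gt0 h x :
  (0 < degree (picker_graph h) x) = ~~ uncovered h x.
Proof.
rewrite card_gt0 -has_predC; apply/set0Pn/hasP => [[a] | [a ha /negPn xa]].
  by rewrite !inE => /andP[ha xa]; exists a => //; apply/negPn.
by exists a; rewrite !inE ha.
Qed.

Lemma uncovered_rcons h c p x :
  uncovered (rcons h (c, p)) x = (x \notin p) && uncovered h x.
Proof. by rewrite /uncovered /unzip2 map_rcons all_rcons. Qed.

Definition safe h : Prop :=
  (forall x, uncovered h x -> 2 <= degree (unclaimed e h) x) /\
  (forall x y, uncovered h x -> uncovered h y ->
     degree (unclaimed e h) x < 3 -> degree (unclaimed e h) y < 3 -> x = y).

Definition urgent h x : bool :=
  uncovered h x &&
  [forall (y | uncovered h y),
     degree (unclaimed e h) x <= degree (unclaimed e h) y].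

Lemma exists_urgent h x : uncovered h x -> exists y, urgent h y.
Proof.
move=> ux; case: (arg_minnP (degree (unclaimed e h)) ux) => y uy y_min.
by exists y; rewrite /urgent uy; apply/forall_inP.
Qed.

(** By minimality of [x] at most [x] itself was endangered.  Playing at [x]
    covers it, so the only vertex that can be endangered afterwards is the end
    of [c] other than [x]. *)
Lemma safe_rcons h c p x :
    simple_graph e -> safe h -> urgent h x ->
    c \in unclaimed e h -> p \in unclaimed e h -> c != p ->
    x \in c -> x \in p ->
  safe (rcons h (c, p)).
Proof.
move=> simple_e [_ uniq_h] /andP[ux /forall_inP x_min] cU pU neq_cp xc xp.
(* A vertex still uncovered was not endangered before the round, and it lost
     at most the edge [c], since [p] would have covered it. *)
have step y : uncovered (rcons h (c, p)) y ->
    y != x /\ 3 <= degree (unclaimed e (rcons h (c, p))) y + (y \in c).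
  rewrite uncovered_rcons => /andP[yp uy].
  have neq_yx : y != x by apply: contraNneq yp => ->.
  split=> //; rewrite unclaimed_rcons.
  have pU' : p \in unclaimed e h :\ c by rewrite in_setD1 eq_sym neq_cp.
  have := degreeD1 y cU; rewrite (degreeD1 y pU') (negPf yp) add0n addnC => <-.
  rewrite leqNgt; apply: contra neq_yx => dy; apply/eqP/uniq_h => //.
  exact: leq_ltn_trans (x_min y uy) dy.
have /eqP cC1 : #|c :\ x| == 1.
  have cE : c \in edges e by move: cU; rewrite inE => /andP[].
  by have := cardsD1 x c; rewrite xc (card_edge simple_e cE); lia.
split=> [y /step[_] | y z /step[neq_yx dy] /step[neq_zx dz] dy3 dz3].
  by case: (y \in c); lia.
have yc : y \in c by move: dy; case: (y \in c) => //; lia.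
have zc : z \in c by move: dz; case: (z \in c) => //; lia.
have [w cw] := cards1P (introT eqP cC1).
have : y \in c :\ x by rewrite in_setD1 neq_yx.
have : z \in c :\ x by rewrite in_setD1 neq_zx.
by rewrite cw !inE => /eqP-> /eqP->.
Qed.

(** * Picker's strategy *)

(** Once every vertex is covered, any two unclaimed edges will do: Picker only
    has to complete the game legally. *)
Definition candidates h : {set {set T}} :=
  if [pick x | urgent h x] is Some x then [set a in unclaimed e h | x \in a]
  else unclaimed e h.

Definition urgent_strategy : picker_strategy T :=
  fun h => (nth set0 (enum (candidates h)) 0, nth set0 (enum (candidates h)) 1).

Lemma candidates_unclaimed h a : a \in candidates h -> a \in unclaimed e h.
Proof.
by rewrite /candidates; case: pickP => // x _; rewrite inE => /andP[].
Qed.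

Lemma urgent_strategyP h :
    safe h -> ~~ game_over e h ->
  [/\ (urgent_strategy h).1 \in candidates h,
      (urgent_strategy h).2 \in candidates h
    & (urgent_strategy h).1 != (urgent_strategy h).2].
Proof.
move=> [deg2 _]; rewrite /game_over -ltnNge => unfinished.
have gt1 : 1 < size (enum (candidates h)).
  rewrite -cardE /candidates; case: pickP => // x /andP[ux _].
  exact: deg2.
by split; rewrite /= -1?mem_enum ?mem_nth ?nth_uniq ?enum_uniq // ltnW.
Qed.

Lemma safe_candidates h c p :
    simple_graph e -> safe h ->
    c \in candidates h -> p \in candidates h -> c != p ->
  safe (rcons h (c, p)).
Proof.
move=> simple_e safe_h; rewrite /candidates; case: pickP => [x urg_x | none].
  by move=> /setIdP[cU xc] /setIdP[pU xp] neq_cp; apply: safe_rcons urg_x _ _ _ _ _.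
move=> _ _ _; have all_covered x : uncovered (rcons h (c, p)) x = false.
  rewrite uncovered_rcons; apply/negP => /andP[_ /exists_urgent[y]].
  by rewrite none.
by split=> [x | x y]; rewrite all_covered.
Qed.

Lemma play_safe h :
    simple_graph e -> (forall x, 3 <= degree (edges e) x) ->
  play e urgent_strategy h -> safe h.
Proof.
move=> simple_e deg3; elim=> [|{}h _ safe_h unfin|{}h _ safe_h unfin].
- split=> [x _ | x y _ _]; rewrite unclaimed_nil; first exact: ltnW.
  by rewrite ltnNge deg3.
- have [c1 c2 neq] := urgent_strategyP safe_h unfin.
  exact: safe_candidates.
- have [c1 c2 neq] := urgent_strategyP safe_h unfin.
  by apply: safe_candidates => //; rewrite eq_sym.
Qed.

(** An uncovered vertex of a safe history has two unclaimed edges, which is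
    more than a finished game leaves over. *)
Lemma min_degree3_guarantees1 :
    simple_graph e -> (forall x, 3 <= degree (edges e) x) ->
  picker_guarantees e 1.
Proof.
move=> simple_e deg3; exists urgent_strategy => h h_play.
  have safe_h := play_safe simple_e deg3 h_play => unfin.
  by case: (urgent_strategyP safe_h unfin); split=> //; apply: candidates_unclaimed.
have [deg2 _] := play_safe simple_e deg3 h_play => fin x.
rewrite degree_picker_gt0; apply/negP => /deg2 dx.
by have := leq_trans dx (degree_le_card _ _); rewrite ltnNge => /negP.
Qed.

(** * The upper bound by counting *)

Lemma card_unclaimed_play s h :
    legal e s -> play e s h ->
  #|unclaimed e h| + (size h).*2 = #|edges e|.
Proof.
move=> legal_s.
have step g c p : c \in unclaimed e g -> p \in unclaimed e g -> c != p ->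
    #|unclaimed e g| + (size g).*2 = #|edges e| ->
    #|unclaimed e (rcons g (c, p))| + (size (rcons g (c, p))).*2 = #|edges e|.
  move=> cU pU neq_cp <-; rewrite unclaimed_rcons size_rcons.
  rewrite (cardsD1 c (unclaimed e g)) cU (cardsD1 p (_ :\ c)) in_setD1.
  by rewrite (eq_sym p) neq_cp pU !add1n doubleS !addnS !addSn.
elim=> [|{}h h_play IH unfin|{}h h_play IH unfin].
- by rewrite unclaimed_nil addn0.
- by have [? ? ?] := legal_s h h_play unfin; apply: step.
- by have [? ? ?] := legal_s h h_play unfin; apply: step; rewrite // eq_sym.
Qed.

Lemma picker_graph_play_sub s h :
  legal e s -> play e s h -> picker_graph h \subset edges e.
Proof.
move=> legal_s h_play; apply/subsetP => a; rewrite inE.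
have sub_edges g b : b \in unclaimed e g -> b \in edges e.
  by rewrite inE => /andP[].
elim: h_play => [|{}h h_play IH unfin|{}h h_play IH unfin] //.
all: rewrite /unzip2 map_rcons mem_rcons inE => /predU1P[-> | /IH //].
all: by have [? ? _] := legal_s h h_play unfin; apply: sub_edges; eassumption.
Qed.

Lemma card_picker_graph h : #|picker_graph h| <= size h.
Proof. by rewrite cardsE -(size_map snd h); apply: card_size. Qed.

(** The counting bound needs a position to count in: every round uses up two
    unclaimed edges, so prolonging a play must end the game. *)
Lemma exists_finished_play s :
  legal e s -> exists2 h, play e s h & game_over e h.
Proof.
move=> legal_s.
have long n : (exists2 h, play e s h & game_over e h) \/
    (exists2 h, play e s h & size h = n).
  elim: n => [|n [fin | [h h_play sz_h]]]; [|by left|].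
    by right; exists [::]; first exact: play_start.
  have [fin | unfin] := boolP (game_over e h); first by left; exists h.
  by right; exists (rcons h ((s h).1, (s h).2));
    [exact: play_fst | rewrite size_rcons sz_h].
have [// | [h h_play sz_h]] := long #|edges e|.+1.
by have := card_unclaimed_play legal_s h_play; lia.
Qed.

(** Count the incidences of Picker's edges at the end of a play.  If every
    vertex has [t] of them, there are at least [#|T| * t]; but Picker owns at
    most half of the [#|T| * k / 2] edges, giving at most [#|T| * k / 2]
    incidences. *)
Lemma guarantee_le_half k t :
    simple_graph e -> regular e k -> 0 < #|T| -> picker_guarantees e t ->
  t.*2 <= k.
Proof.
move=> simple_e reg_k T_gt0 [s legal_s guar].
have [h h_play fin] := exists_finished_play legal_s.
have edge_sum : #|T| * k = #|edges e|.*2.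
  rewrite -(handshake simple_e (subxx _)) -sum_nat_const.
  by apply: eq_bigr => x _; rewrite reg_k.
have picker_sum : #|T| * t <= #|picker_graph h|.*2.
  rewrite -(handshake simple_e (picker_graph_play_sub legal_s h_play)).
  by rewrite -sum_nat_const; apply: leq_sum => x _; apply: guar.
rewrite -(leq_pmul2l T_gt0) -doubleMr edge_sum.
have := card_unclaimed_play legal_s h_play.
by have := card_picker_graph h; lia.
Qed.

End Game.

Theorem theorem1 (T : finType) (e : rel T)
    (simple_e : simple_graph e) (regular_e : regular e 3) :
  picker_guarantees e 1 /\
  (0 < #|T| -> exists2 t : nat, is_delta_P e t & 1 <= t).
Proof.
have guar1 : picker_guarantees e 1.
  by apply: min_degree3_guarantees1 => // x; rewrite regular_e.
split=> // T_gt0; exists 1 => //; split=> // t guar_t.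
by have := guarantee_le_half simple_e regular_e T_gt0 guar_t; lia.
Qed.
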